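(* For $n\ge 1$ let $X(n)$ be the number of parts of an Arndt composition of $n$ chosen uniformly at random. Then, as $n\to\infty$, $$\mathbb{E}[X(n)]\sim\left(\frac{3}{\sqrt 5}-1\right)n.$$
   Context: A composition of $n$ is a finite sequence $(\sigma_1,\dots,\sigma_\ell)$ of positive integers summing to $n$; $\ell$ is its number of parts. An Arndt composition is one with $\sigma_{2i-1}>\sigma_{2i}$ for every positive integer $i$ with $2i\le\ell$. *)

(* Defs.v *)
From mathcomp Require Import all_boot all_order all_algebra.
From mathcomp Require Import all_classical all_reals all_analysis.
Set Implicit Arguments.
Unset Strict Implicit.
Unset Printing Implicit Defensive.
Import Order.TTheory GRing.Theory Num.Theory.
Import numFieldNormedType.Exports.

Local Open Scope nat_scope.

Definition composition (n : nat) (s : seq nat) : bool :=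
  all (fun k => 0 < k) s && (sumn s == n).

(* Parts are indexed from 1. *)
Definition part (s : seq nat) (i : nat) : nat := nth 0 s i.-1.

(* Bounding i by size s loses nothing, since 2 * i <= size s. *)
Definition arndt (s : seq nat) : bool :=
  [forall i : 'I_(size s).+1,
    (0 < i) && (2 * i <= size s) ==> (part s (2 * i - 1) > part s (2 * i))].

(* A composition of n has at most n parts, each at most n, so it is an element
   of the finite type n.-bseq 'I_n.+1; arndt_compositionsP shows that nothing
   is lost by this encoding. *)
Definition parts (n : nat) (s : n.-bseq 'I_n.+1) : seq nat :=
  [seq val k | k <- s].

Definition arndt_compositions (n : nat) : {set n.-bseq 'I_n.+1} :=
  [set s | composition n (parts s) && arndt (parts s)].

Lemma arndtP (s : seq nat) :
  reflect (forall i, 0 < i -> 2 * i <= size s ->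
             part s (2 * i - 1) > part s (2 * i))
          (arndt s).
Proof.
apply: (iffP forallP) => [h i i0 is_|h i].
- have lti : i < (size s).+1.
    by rewrite ltnS (leq_trans _ is_)// leq_pmull.
  by move: (h (Ordinal lti)) => /=; rewrite i0 is_.
- by apply/implyP => /andP[i0 is_]; exact: h.
Qed.

Lemma parts_inj (n : nat) : injective (@parts n).
Proof. by move=> s t /(inj_map val_inj) /val_inj. Qed.

Lemma arndt_compositionsP (n : nat) (s : seq nat) :
  reflect (exists2 t, t \in arndt_compositions n & parts t = s)
          (composition n s && arndt s).
Proof.
apply: (iffP idP) => [|[t + <-]]; last by rewrite inE.
move=> cas; have /andP[/andP[s0 /eqP sn] _] := cas.
have le_part k : k \in s -> k <= n.
  rewrite -sn; elim: s {cas s0 sn} => //= a s IH.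
  rewrite inE => /predU1P[->|/IH h]; first exact: leq_addr.
  exact: leq_trans h (leq_addl _ _).
have sizes : size s <= n.
  rewrite -sn; elim: s s0 {cas sn le_part} => //= a s IH /andP[a0 /IH h].
  by rewrite -add1n leq_add.
have szt : size [seq inord k : 'I_n.+1 | k <- s] <= n by rewrite size_map.
have pt : parts (Bseq szt) = s.
  rewrite /parts /= -map_comp -[RHS]map_id; apply/eq_in_map => k /le_part kn.
  by rewrite /= inordK.
by exists (Bseq szt) => //; rewrite inE pt.
Qed.

Local Open Scope ring_scope.

Definition uniform_pmf (R : realType) (T : finType) (A : {set T}) (x : T) : R :=
  if x \in A then #|A|%:R^-1 else 0.

Definition expected_value (R : realType) (T : finType) (p X : T -> R) : R :=
  \sum_(x : T) p x * X x.

Definition num_parts (R : realType) (n : nat) (s : n.-bseq 'I_n.+1) : R :=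
  (size (parts s))%:R.

Definition mean_num_parts (R : realType) (n : nat) : R :=
  expected_value (uniform_pmf R (arndt_compositions n)) (@num_parts R n).

(* Main.v *)
Require Import Defs.
From mathcomp Require Import all_boot all_order all_algebra.
From mathcomp Require Import all_classical all_reals all_analysis.
From mathcomp Require Import zify ring lra.
Import Order.TTheory GRing.Theory Num.Theory.
Import numFieldNormedType.Exports.

(* Call an Arndt composition tight if its first two parts are b + 1, b.
   Incrementing the first part maps the Arndt compositions of n bijectively
   onto the non-tight ones of n + 1. A tight composition of n + 3 comes either
   from a tight one of n + 1 by incrementing its first two parts, or from an
   Arndt composition of n by prepending 2, 1. Hence for n >= 4 the number of
   Arndt compositions of n satisfies the Fibonacci recurrence, and their total
   number of parts satisfies t(n) = t(n-1) + t(n-2) + 2 fib(n-3), so that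
   5 t(n) = n (6 fib(n+1) - 8 fib n) + 27 fib n - 15 fib(n+1) for n >= 2.
   Since fib(n+1) differs from the golden ratio times fib n by at most 1, the
   mean t(n) / fib n differs from (3 / sqrt 5 - 1) n by a bounded amount. *)

(** * Recursive enumeration of Arndt compositions *)

Local Open Scope nat_scope.

Lemma arndt_cons2 (a b : nat) (s : seq nat) :
  arndt (a :: b :: s) = (b < a) && arndt s.
Proof.
have partS i : 0 < i -> part (a :: b :: s) (2 * i.+1) = part s (2 * i)
    /\ part (a :: b :: s) (2 * i.+1 - 1) = part s (2 * i - 1).
  by case: i => // i _; rewrite /part !mulnS.
apply/arndtP/andP => [h|[ba /arndtP h] [|[|i]] // _ le_i].
- split; first exact: (h 1).
  apply/arndtP => i i0 le_i; have [<- <-] := partS i i0.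
  by apply: h => //=; lia.
- by have [-> ->] := partS i.+1 isT; apply: h => //; move: le_i => /=; lia.
Qed.

Lemma arndt_size1 (s : seq nat) : size s <= 1 -> arndt s.
Proof. by move=> s1; apply/arndtP => i i0 le_i; lia. Qed.

Definition tight (s : seq nat) : bool :=
  if s is a :: b :: _ then a == b.+1 else false.

(** The empty sequence goes to [[:: 1]], so that the step from sum 0 to sum 1 is covered too. *)
Definition incr_head (s : seq nat) : seq nat :=
  if s is a :: s' then a.+1 :: s' else [:: 1].

Definition incr_head2 (s : seq nat) : seq nat :=
  if s is a :: b :: s' then a.+1 :: b.+1 :: s' else s.

Definition arndt_comp (n : nat) : pred (seq nat) :=
  [pred s | composition n s && arndt s].

Definition tight_comp (n : nat) : pred (seq nat) :=
  [pred s | [&& composition n s, arndt s & tight s]].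

Definition enumerates (P : pred (seq nat)) (l : seq (seq nat)) : Prop :=
  uniq l /\ l =i P.

Lemma enumerates_arndtS (n : nat) (l g : seq (seq nat)) :
  enumerates (arndt_comp n) l -> enumerates (tight_comp n.+1) g ->
  enumerates (arndt_comp n.+1) (map incr_head l ++ g).
Proof.
move=> [ul ml] [ug mg]; split.
  rewrite cat_uniq ug andbT map_inj_in_uniq ?ul /=.
    apply/hasPn => s; rewrite mg => /and3P[_ _ ts]; apply/mapP => -[s'].
    rewrite ml => /andP[_ as'] es; move: ts as'; rewrite es.
    case: s' {es} => [|a [|b s']] //=; rewrite arndt_cons2.
    by move=> /eqP[->]; rewrite ltnn.
  (* Both [[::]] and [[:: 0]] map to [[:: 1]], so injectivity rests on the parts being positive. *)
  move=> [|a s] [|b t] //; rewrite !ml /= => hs ht [].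
  - by move=> b0; move: ht; rewrite -b0 !inE /composition.
  - by move=> a0; move: hs; rewrite a0 !inE /composition.
  - by move=> -> ->.
move=> s; rewrite mem_cat mg; apply/orP/idP => [[/mapP[s'] + ->|/and3P[sn sa _]]|].
- rewrite ml; case: s' => [|a [|b s']].
  - by rewrite !inE /composition /= => /andP[/eqP <- _]; rewrite arndt_size1.
  - by rewrite !inE /composition /= !arndt_size1 // !andbT !addn0 => /andP[_ /eqP->].
  - rewrite !inE /composition /= !arndt_cons2 addSn eqSS.
    by move=> /andP[/andP[/andP[_ ->] ->] /andP[ba ->]]; rewrite andbT ltnW.
- by rewrite inE sn.
case: s => [|[|a] [|b s]] //.
- rewrite !inE /composition /= arndt_size1 // andbT addn0 eqSS => /eqP an.
  left; case: a an => [|a] an.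
    by apply/mapP; exists [::] => //; rewrite ml !inE /composition /= -an arndt_size1.
  apply/mapP; exists [:: a.+1] => //.
  by rewrite ml !inE /composition /= addn0 an eqxx arndt_size1.
- move=> h; case: (eqVneq a b) => [ab|nab].
    by right; move: h; rewrite !inE => /andP[-> ->]; rewrite /= ab eqxx.
  left; apply/mapP; exists (a :: b :: s) => //; rewrite ml.
  move: h; rewrite !inE /composition /= !arndt_cons2 addSn eqSS ltnS.
  move=> /andP[/andP[/andP[b0 ->] ->] /andP[ba ->]].
  have lt_ba : b < a by rewrite ltn_neqAle eq_sym nab.
  by rewrite b0 lt_ba (leq_ltn_trans _ lt_ba).
Qed.

Lemma enumerates_tightS3 (n : nat) (l g : seq (seq nat)) :
  enumerates (arndt_comp n) l -> enumerates (tight_comp n.+1) g ->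
  enumerates (tight_comp n.+3) (map incr_head2 g ++ [seq 2 :: 1 :: s | s <- l]).
Proof.
move=> [ul ml] [ug mg]; split.
  rewrite cat_uniq; apply/and3P; split.
  - rewrite map_inj_in_uniq // => -[|a [|b s]] [|a' [|b' s']];
      rewrite !mg !inE ?andbF //= => _ _ [-> -> ->] //.
  (* Disjointness: parts are positive, so [incr_head2] yields a second part of at least 2. *)
  - apply/hasPn => s /mapP[s' _ ->]; apply/mapP => -[[|a [|b t]]];
      rewrite mg !inE ?andbF //= => h [_ b0 _]; move: h.
    by rewrite -b0 /composition /= andbF.
  - by rewrite map_inj_uniq // => s s' [].
move=> s; rewrite mem_cat; apply/orP/idP => [[/mapP[s'] + ->|/mapP[s'] + ->]|].
- rewrite mg; case: s' => [|a [|b s']]; rewrite !inE ?andbF //.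
  rewrite /composition /= !arndt_cons2 ltnS eqSS.
  move=> /and3P[/andP[/and3P[_ _ ->] /eqP sn] /andP[-> ->] ->].
  by rewrite !andbT /=; apply/eqP; lia.
- rewrite ml !inE /composition /= arndt_cons2 /= => /andP[/andP[-> /eqP ->] ->].
  by rewrite !andbT; apply/eqP; lia.
case: s => [|a [|b s]]; rewrite !inE ?andbF //.
rewrite /composition /= arndt_cons2.
move=> /and3P[/andP[/and3P[_ b0 s0] /eqP sn] /andP[_ h] /eqP ab].
(* A second part 1 forces the head 2, 1, which is dropped; otherwise the first two parts are
   decremented. *)
case: b b0 sn ab => [|[|b]] // _ sn ab; rewrite {}ab in sn *; [right|left].
- apply/mapP; exists s => //; rewrite ml !inE /composition s0 h andbT.
  by apply/eqP; lia.
- apply/mapP; exists [:: b.+2, b.+1 & s] => //.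
  rewrite mg !inE /composition /= s0 arndt_cons2 h ltnS leqnn !eqxx !andbT /=.
  by apply/eqP; lia.
Qed.

(* Stage n holds the enumerations of the Arndt compositions of n and of the
   tight ones of n + 1 and n + 2. *)
Fixpoint arndt_stage (n : nat) :
    seq (seq nat) * seq (seq nat) * seq (seq nat) :=
  if n is n'.+1 then
    let: (l, g1, g2) := arndt_stage n' in
    (map incr_head l ++ g1, g2,
     map incr_head2 g1 ++ [seq 2 :: 1 :: s | s <- l])
  else ([:: [::]], [::], [::]).

Lemma arndt_stageS (n : nat) :
  arndt_stage n.+1 =
  let: (l, g1, g2) := arndt_stage n in
  (map incr_head l ++ g1, g2,
   map incr_head2 g1 ++ [seq 2 :: 1 :: s | s <- l]).
Proof. by []. Qed.

Lemma arndt_stageP (n : nat) :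
  let: (l, g1, g2) := arndt_stage n in
  [/\ enumerates (arndt_comp n) l, enumerates (tight_comp n.+1) g1
    & enumerates (tight_comp n.+2) g2].
Proof.
elim: n => [|n] /=; last first.
  case: arndt_stage => -[l g1] g2 [hl hg1 hg2]; split=> //.
    exact: enumerates_arndtS.
  exact: enumerates_tightS3.
(* The least sum of a tight composition is 3, so both tight lists start empty. *)
split; split=> // s; rewrite !inE.
- case: s => [|a s]; first by rewrite /composition arndt_size1.
  rewrite /composition /=; apply/esym/negP => /andP[/andP[/andP[a0 _] /eqP]].
  by move: a0; lia.
- case: s => [|a [|b s]]; rewrite ?andbF //= /composition /=.
  apply/esym/negP => /and3P[/andP[/and3P[a0 b0 _] /eqP + _ _]].
  by move: a0 b0; lia.
- case: s => [|a [|b s]]; rewrite ?andbF //= /composition /= arndt_cons2.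
  apply/esym/negP => /and3P[/andP[/and3P[a0 b0 _] /eqP +] /andP[ba _] _].
  by move: a0 b0 ba; lia.
Qed.

(** * Fibonacci counts and total numbers of parts *)

Fixpoint fib (n : nat) : nat :=
  if n is n'.+1 then if n' is n''.+1 then fib n' + fib n'' else 1 else 0.

Lemma fibSS (n : nat) : fib n.+2 = fib n.+1 + fib n.
Proof. by []. Qed.

Definition total_size (l : seq (seq nat)) : nat := sumn (map size l).

Lemma total_size_cat (l l' : seq (seq nat)) :
  total_size (l ++ l') = total_size l + total_size l'.
Proof. by rewrite /total_size map_cat sumn_cat. Qed.

Lemma total_size_incr_head (l : seq (seq nat)) :
  [::] \notin l -> total_size (map incr_head l) = total_size l.
Proof.
rewrite /total_size -map_comp => l0; congr sumn; apply/eq_in_map => -[|a s] //.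
by rewrite (negPf l0).
Qed.

Lemma total_size_incr_head2 (l : seq (seq nat)) :
  total_size (map incr_head2 l) = total_size l.
Proof.
by rewrite /total_size -map_comp; congr sumn; apply/eq_map => -[|a [|b s]].
Qed.

Lemma total_size_cons2 (a b : nat) (l : seq (seq nat)) :
  total_size [seq a :: b :: s | s <- l] = total_size l + 2 * size l.
Proof. by elim: l => //= s l; rewrite /total_size /= => ->; lia. Qed.

(* The negative terms of the closed form stand on the left. *)
Lemma arndt_stage_sizes (m : nat) : let n := m.+2 in
  let: (l, g1, g2) := arndt_stage n in
  [/\ size l = fib n, size g1 = fib m.+1, size g2 = fib n &
   let t k T := 5 * T + 8 * k * fib k + 15 * fib k.+1
                = 6 * k * fib k.+1 + 27 * fib k in
   [/\ t n (total_size l), t n.+1 (total_size l + total_size g1)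
     & t n.+2 (total_size l + total_size g1 + total_size g2)]].
Proof.
(* Incrementing keeps the number of parts, so the three sums are the totals for [n], [n.+1] and
   [n.+2], enough to run the recurrence. *)
move=> n; rewrite {}/n; elim: m => [|m] //.
have := arndt_stageP m.+2.
rewrite (arndt_stageS m.+2); case: (arndt_stage m.+2) => -[l g1] g2.
move=> [[_ ml] _ _] [sl s1 s2 [t0 t1 t2]].
rewrite !size_cat !size_map !total_size_cat total_size_incr_head ?ml //.
rewrite total_size_incr_head2 total_size_cons2 sl s1 s2; split=> //.
- by rewrite addnC.
(* Only the third equation is new; its recurrence adds [2 * fib m.+2], from the parts 2, 1 prepended
   to each element of [l]. *)
- split=> //; move: t0 t1 t2; rewrite !fibSS.
  by move: (fib m.+1) (fib m) => x y; nia.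
Qed.

(** Keeps the error term of order [n / fib n] in the mean bounded. *)
Lemma leq_double_fib (n : nat) : n <= 2 * fib n.
Proof.
suff: n <= 2 * fib n /\ n.+1 <= 2 * fib n.+1 by case.
by elim: n => // -[|n] [h1 h2]; split=> //; move: h1 h2; rewrite !fibSS; lia.
Qed.

(** * The mean and its asymptotics *)

Local Open Scope classical_set_scope.
Local Open Scope ring_scope.

Lemma mean_num_partsE (R : realType) (n : nat) :
  let l := (arndt_stage n).1.1 in
  mean_num_parts R n = (total_size l)%:R / (size l)%:R.
Proof.
move=> l; have [ul ml] : enumerates (arndt_comp n) l.
  by move: (arndt_stageP n); rewrite /l; case: arndt_stage => -[? ?] ? [].
(* Both lists are duplicate-free with the same members, so counts and totals can be read off [l]. *)
have pl : perm_eq [seq parts s | s in arndt_compositions n] l.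
  apply: uniq_perm ul _; first by rewrite map_inj_uniq ?enum_uniq//; exact: parts_inj.
  move=> s; rewrite ml; apply/mapP/arndt_compositionsP => -[t].
    by rewrite mem_enum => ? ->; exists t.
  by move=> ? <-; exists t => //; rewrite mem_enum.
have -> : size l = #|arndt_compositions n| by rewrite -(perm_size pl) size_map -cardE.
have -> : total_size l = (\sum_(s in arndt_compositions n) size (parts s))%N.
  rewrite /total_size -(perm_sumn (perm_map size pl)) sumnE !big_map.
  by rewrite big_enum.
rewrite /mean_num_parts /expected_value natr_sum mulr_suml [RHS]big_mkcond /=.
by apply: eq_bigr => s _; rewrite /uniform_pmf; case: ifP; rewrite ?mul0r // mulrC.
Qed.

(** The difference is exactly the [n]-th power of the conjugate root [(1 - Num.sqrt 5) / 2], whose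
    modulus is below 1. *)
Lemma fib_golden_ratio_err (R : realType) (n : nat) :
  `|(fib n.+1)%:R - (1 + Num.sqrt 5) / 2 * (fib n)%:R| <= 1 :> R.
Proof.
set r : R := Num.sqrt 5.
have r2 : r * r = 5 by rewrite -expr2 sqr_sqrtr.
have r0 : 0 <= r by exact: sqrtr_ge0.
have -> : (fib n.+1)%:R - (1 + r) / 2 * (fib n)%:R = ((1 - r) / 2) ^+ n.
  elim: n => [|n IH]; first by rewrite /= mulr0 subr0.
  rewrite exprS -IH fibSS natrD; move: (fib n.+1)%:R (fib n)%:R => y x.
  rewrite (_ : (1 - r) / 2 * _ = (1 - r) / 2 * y - (1 - r * r) / 4 * x).
    by rewrite r2; field.
  by field.
by rewrite normrX exprn_ile1 // ler_norml; apply/andP; split; nra.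
Qed.

Lemma mean_num_parts_err (R : realType) (n : nat) : (1 < n)%N ->
  `|mean_num_parts R n - (3 / Num.sqrt 5 - 1) * n%:R| <= 6.
Proof.
case: n => [|[|m]] // _; rewrite mean_num_partsE.
have := arndt_stage_sizes m; cbv zeta; case: (arndt_stage m.+2) => -[l g1] g2.
move=> [-> _ _ [t0 _ _]]; rewrite [_.1.1]/=.
have := leq_double_fib m.+2; have := fib_golden_ratio_err R m.+2.
have : (0 < m.+2)%N by [].
move: t0; move: m.+2 (fib m.+2) (fib m.+3) (total_size l) => n x y t.
move=> /(congr1 (fun k => k%:R : R)) + n_gt0 + n_le.
have : 1 <= x%:R :> R by rewrite ler1n; lia.
have : 0 <= n%:R :> R by [].
move: n_le; rewrite !natrD !natrM -(ler_nat R) natrM {n_gt0}.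
move: x%:R y%:R t%:R n%:R => {}x {}y {}t {}n.
set r : R := Num.sqrt 5.
have r2 : r * r = 5 by rewrite -expr2 sqr_sqrtr.
have r0 : 0 <= r by exact: sqrtr_ge0.
(* In this range [(39 - 15 * r) / 2], a coefficient below, lies between -3 and 3. *)
have [r_ge r_le] : 11 / 5 <= r /\ r <= 3 by split; nra.
move=> n_le n0 x1 t_eq d_le.
have x0 : 0 < x by exact: lt_le_trans x1.
have -> : 3 / r - 1 = 3 * r / 5 - 1.
  by rewrite -r2; field; apply/eqP => r_0; rewrite r_0 in r_ge; lra.
set d := y - _ in d_le.
(* Substituting [y = d + (1 + r) / 2 * x] cancels the main term. As [n <= 2 * x] and [1 <= x], the
   rest is at most [(12 + 3 + 15) / 5 = 6]. *)
have -> : t / x - (3 * r / 5 - 1) * n =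
    (6 * (n * d) + (39 - 15 * r) / 2 * x - 15 * d) / 5 / x.
  have -> : t = (6 * n * y + 27 * x - 8 * n * x - 15 * y) / 5 by lra.
  by rewrite /d; field; rewrite gt_eqF.
rewrite normrM normfV (gtr0_norm x0) ler_pdivrMr //.
move: d_le; rewrite !ler_norml => /andP[d_ge d_le].
have nd_le : n * d <= n by rewrite ler_piMr.
have nd_ge : - n <= n * d by rewrite -mulrN1 ler_wpM2l.
have rx_le : (39 - 15 * r) / 2 * x <= 3 * x by rewrite ler_wpM2r; lra.
have rx_ge : -3 * x <= (39 - 15 * r) / 2 * x by rewrite ler_wpM2r; lra.
by apply/andP; split; lra.
Qed.

Theorem theorem2p7 (R : realType) :
  (fun n : nat => mean_num_parts R n) ~_\oo
  (fun n : nat => (3 / Num.sqrt 5 - 1) * n%:R).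
Proof.
set k : R := 3 / Num.sqrt 5 - 1.
have k0 : 0 < k.
  rewrite /k subr_gt0 ltr_pdivlMr ?sqrtr_gt0 // mul1r.
  have r0 : 0 <= Num.sqrt 5 :> R by exact: sqrtr_ge0.
  have r2 : Num.sqrt 5 * Num.sqrt 5 = 5 :> R by rewrite -expr2 sqr_sqrtr.
  by nra.
apply/eqaddoP => e e0; near=> n.
have n1 : (1 < n)%N by near: n; exact: nbhs_infty_gt.
(* The bounded error is negligible once [n >= 6 / (e * k)]. *)
apply: (le_trans (mean_num_parts_err R n n1)).
rewrite normrM (gtr0_norm k0) ger0_norm // mulrA mulrC -ler_pdivrMr ?mulr_gt0 //.
by near: n; exact: nbhs_infty_ger.
Unshelve. all: by end_near. Qed.
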